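(* For every graph $G$, the treewidth of $G$ satisfies $\operatorname{tw}(G)\le 15\,\operatorname{sn}(G)$, where $\operatorname{sn}(G)$ is the separation number of $G$.
   Context: Graphs are finite and undirected. A separation of a graph $H$ is a pair $(A,B)$ of subsets of $V(H)$ such that $A\cup B=V(H)$ and no edge of $H$ has one end in $A\setminus B$ and the other in $B\setminus A$. The order of the separation $(A,B)$ is $|A\cap B|$. A separation $(A,B)$ of a graph $H$ on $n$ vertices is balanced if $|A\setminus B|\le 2n/3$ and $|B\setminus A|\le 2n/3$. The separation number $\operatorname{sn}(G)$ of a graph $G$ is the smallest integer $s$ such that every subgraph of $G$ has a balanced separation of order at most $s$. $\operatorname{tw}(G)$ denotes the (usual) treewidth of $G$. *)

(* Defs.v *)
From mathcomp Require Import all_boot.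
From mathcomp Require Import boolp.

Set Implicit Arguments.
Unset Strict Implicit.
Unset Printing Implicit Defensive.

(* Loops are allowed, and parallel edges are not represented: neither has any *)
(* effect on separations or on tree-decompositions.                           *)
Record graph := Graph {
  vertex :> finType;
  edge : rel vertex;
  edge_sym : symmetric edge
}.

Arguments edge {g}.

Record subgraph (G : graph) := Subgraph {
  sub_vertices : {set G};
  sub_edge : rel G;
  sub_edge_sym : symmetric sub_edge;
  sub_edgeP : forall x y : G, sub_edge x y ->
    [/\ x \in sub_vertices, y \in sub_vertices & edge x y]
}.

Definition graph_of_subgraph (G : graph) (H : subgraph G) : graph :=
  @Graph {x : G | x \in sub_vertices H}
         (fun x y => sub_edge H (val x) (val y))
         (fun x y => sub_edge_sym H (val x) (val y)).

Coercion graph_of_subgraph : subgraph >-> graph.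

Definition separation (H : graph) (A B : {set H}) : Prop :=
  A :|: B = [set: H] /\
  forall x y : H, x \in A :\: B -> y \in B :\: A -> ~~ edge x y.

Definition balanced (H : graph) (A B : {set H}) : Prop :=
  3 * #|A :\: B| <= 2 * #|H| /\ 3 * #|B :\: A| <= 2 * #|H|.

Definition sn_at_most (G : graph) (s : nat) : Prop :=
  forall H : subgraph G, exists A B : {set H},
    [/\ separation A B, balanced A B & #|A :&: B| <= s].

Lemma sn_at_most_ex (G : graph) : exists s : nat, `[< sn_at_most G s >].
Proof.
exists #|G|; apply/asboolP => H.
exists [set: H], [set: H]; split.
- by split=> [|x y]; rewrite ?setUid // setDv inE.
- by rewrite /balanced setDv cards0.
- rewrite setIid cardsT.
  exact: (leq_card (val : H -> G) val_inj).
Qed.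

Definition sn (G : graph) : nat := ex_minn (sn_at_most_ex G).

Definition connected_in (G : graph) (S : {set G}) : Prop :=
  {in S &, forall x y,
    connect [rel u v | [&& u \in S, v \in S & edge u v]] x y}.

(* A path [:: x; y] along an edge and back is a ucycle, whence size c <= 2.   *)
Definition tree (T : graph) : Prop :=
  [/\ 0 < #|T|, irreflexive (@edge T), connected_in [set: T]
    & forall c : seq T, ucycle edge c -> size c <= 2].

Definition tree_decomposition (G T : graph) (bag : T -> {set G}) : Prop :=
  [/\ tree T,
      forall x : G, exists t : T, x \in bag t,
      forall x y : G, edge x y -> exists t : T, x \in bag t /\ y \in bag t
    & forall x : G, connected_in [set t : T | x \in bag t]].

(* The predecessor is truncated: the graph without vertices gets width 0      *)
(* rather than -1.                                                            *)
Definition width (G T : graph) (bag : T -> {set G}) : nat :=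
  (\max_(t : T) #|bag t|).-1.

Definition has_tree_decomposition_of_width (G : graph) (k : nat) : Prop :=
  exists (T : graph) (bag : T -> {set G}),
    tree_decomposition bag /\ width bag = k.

Lemma has_tree_decomposition_ex (G : graph) :
  exists k : nat, `[< has_tree_decomposition_of_width G k >].
Proof.
pose T : graph := @Graph unit (fun _ _ => false) (fun _ _ => erefl).
pose bag (_ : T) := [set: G].
exists (width bag); apply/asboolP; exists T, bag; split=> //; split.
- split=> //.
  + by rewrite card_unit.
  + by move=> [] [] _ _; exact: connect0.
  + by case=> // x [|y p] //= /andP[].
- by move=> x; exists tt; rewrite inE.
- by move=> x y _; exists tt; rewrite !inE.
- by move=> x [] [] _ _; exact: connect0.
Qed.

Definition tw (G : graph) : nat := ex_minn (has_tree_decomposition_ex G).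

(* Main.v *)
Require Import Defs.
From mathcomp Require Import all_boot.
From mathcomp Require Import boolp.
From mathcomp Require Import zify.

Set Implicit Arguments.
Unset Strict Implicit.
Unset Printing Implicit Defensive.

(** Let a be the separation number, positive unless the graph is empty.

A tree-decomposition is built recursively, as in the usual approximation of
treewidth: a set W of 10 a vertices, to be contained in the root bag, is split
by a separation of order smaller than the number of vertices of W on each side
([small_bags]). The new root bag consists of W and of the fewer than 5 a vertices
of the separator, and each side is decomposed recursively. So it suffices
to split every W of size 10 a in this way ([exists_splitting_set]).

Suppose that W cannot be split. As W is well linked, each separation has a side,
called small, with few vertices of W. The whole graph may have a balanced
separation, for instance because of large pendant parts that hardly interact
with W, so such parts are pruned. For a suitable integer c, choose a small side
A with boundary S such that the number of vertices outside A plus c |S| is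
minimal. By minimality and the max-flow min-cut theorem, A can send c units of
flow to each vertex of S, with at most c units through each vertex. It has a
subset A' of exactly c |S| vertices that can do so, each vertex sending one unit
([saturated_subset]); this requires c to be an integer. Minimality also says
that adding to A a set outside A, so that the union stays small, adds at most
c vertices per new vertex of the boundary. In the subgraph H induced by A' and
the complement of A, these two facts combine: any separation of order at most a
has a side with at most c a vertices ([light_side]), which is less than a third
of H for the chosen c.

Flows only guide the intuition: everything is expressed by cut conditions and
proved by submodularity of the boundary. *)

(** * Boundaries and cut conditions *)

Section Separations.

Variable G : graph.
Implicit Types S U A P Q X Y W : {set G}.

(** The boundary of P in the subgraph induced by U, where the vertices of S count
as having a neighbour outside U: it is the least possible intersection of P
with the other side of a separation, when this other side must contain the part
of S in P. For a set S of sinks, all flow from P to S passes through it. *)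
Definition boundary S U P :=
  [set v in P | (v \in S) || [exists u in U :\: P, edge v u]].

Lemma boundaryP S U P v :
  reflect (v \in P /\ (v \in S \/ exists u, [/\ u \in U, u \notin P & edge v u]))
          (v \in boundary S U P).
Proof.
rewrite inE; apply: (iffP andP) => -[vP H]; split=> //.
  case/orP: H => [|/exists_inP[u]]; first by left.
  by rewrite !inE => /andP[uP uU] vu; right; exists u.
case: H => [->//|[u [uU uP vu]]]; apply/orP; right.
by apply/exists_inP; exists u => //; rewrite !inE uP.
Qed.

Lemma boundary_sub S U P : boundary S U P \subset P.
Proof. by apply/subsetP=> v /boundaryP[]. Qed.

Lemma boundary_submodular S U P Q :
  #|boundary S U (P :|: Q)| + #|boundary S U (P :&: Q)|
    <= #|boundary S U P| + #|boundary S U Q|.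
Proof.
rewrite -cardsUI -[leqRHS]cardsUI; apply: leq_add; apply: subset_leq_card.
- apply/subsetP=> v /setUP[] /boundaryP[vPQ H]; apply/setUP.
  + case/setUP: vPQ => [vP|vQ]; [left|right]; apply/boundaryP; split=> //.
      case: H => [|[u [uU]]]; first by left.
      by rewrite inE negb_or => /andP[uP _] vu; right; exists u.
    case: H => [|[u [uU]]]; first by left.
    by rewrite inE negb_or => /andP[_ uQ] vu; right; exists u.
  + case/setIP: vPQ => vP vQ.
    case: H => [vS|[u [uU]]]; first by left; apply/boundaryP; split; [|left].
    rewrite inE negb_and => /orP[uP|uQ] vu; [left|right]; apply/boundaryP;
      by split=> //; right; exists u.
- apply/subsetP=> v /setIP[] /boundaryP[_ H] /boundaryP[].
  rewrite inE => /andP[vP vQ] _.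
  case: H => [vS|[u [uU]]].
    by apply/setIP; split; apply/boundaryP; split=> //; left.
  rewrite inE negb_or => /andP[uP uQ] vu.
  by apply/setIP; split; apply/boundaryP; split=> //; right; exists u.
Qed.

(** The hypothesis is the min-cut condition for sending c |S| units of flow from
distinct sources in A to S, with c units through each vertex; the conclusion
is that some A' of the exact size c |S| can send one unit from each of its
vertices to S inside A'. Only the cut conditions are used, never flows. Take a
largest A' satisfying the last condition. A vertex v that cannot be added to A'
is blocked by a tight set containing all its neighbours in A': this is where c
being an integer matters, since adding v raises the demand by one. Tight
sets are closed under union, and the largest one together with the vertices
outside A' yields a cut of A showing that |A'| >= c |S|. *)
Lemma saturated_subset S A c : S \subset A -> 0 < c ->
  (forall P, P \subset A -> c * #|S| <= #|A :\: P| + c * #|boundary S A P|) ->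
  exists A', [/\ S \subset A', A' \subset A, #|A'| = c * #|S| &
    forall P, P \subset A' -> #|P| <= c * #|boundary S A' P|].
Proof.
move=> SA c0 sat.
pose good (D : {set G}) := [&& S \subset D, D \subset A &
  [forall P : {set G}, (P \subset D) ==> (#|P| <= c * #|boundary S D P|)]].
have goodS : good S.
  rewrite /good subxx SA; apply/forallP=> P; apply/implyP=> PS.
  have -> : boundary S S P = P.
    apply/eqP; rewrite eqEsubset boundary_sub; apply/subsetP=> v vP.
    by apply/boundaryP; split=> //; left; exact: (subsetP PS).
  by rewrite leq_pmull.
case: (arg_maxnP (fun D : {set G} => #|D|) goodS) => D /and3P[SD DA /forallP gD] maxD.
have {}gD P : P \subset D -> #|P| <= c * #|boundary S D P| by move/implyP: (gD P).
exists D; split=> //.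
apply/eqP; rewrite eqn_leq; apply/andP; split.
  apply: leq_trans (gD _ (subxx _)) _; rewrite leq_mul2l subset_leq_card ?orbT //.
  apply/subsetP=> v /boundaryP[_ [//|[u [-> //]]]].
pose tight (P : {set G}) := (P \subset D) && (c * #|boundary S D P| <= #|P|).
have tight0 : tight set0.
  rewrite /tight sub0set cards0 leqn0 muln_eq0 cards_eq0 -subset0 boundary_sub.
  by rewrite orbT.
case: (arg_maxnP (fun P : {set G} => #|P|) tight0) => Q /andP[QD tQ] maxQ.
have subQ P : tight P -> P \subset Q.
  move=> /andP[PD tP].
  have PQD : P :|: Q \subset D by rewrite subUset PD.
  have PID : P :&: Q \subset D by rewrite subIset ?PD.
  have /maxQ : tight (P :|: Q).
    rewrite /tight PQD /=.
    have := leq_mul (leqnn c) (boundary_submodular S D P Q).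
    rewrite !mulnDr; move: (gD _ PID) (cardsUI P Q) tP tQ; clear; lia.
  move=> le; have /eqP E : Q == P :|: Q by rewrite eqEcard subsetUr.
  by apply: subset_trans (subsetUl P Q) _; rewrite -E.
pose R := Q :|: (A :\: D).
have RA : R \subset A by rewrite subUset subsetDl (subset_trans QD).
have AR : A :\: R = D :\: Q.
  apply/setP=> x; rewrite !inE; have := subsetP DA x.
  by case: (x \in D); case: (x \in Q); case: (x \in A) => // ->.
(* A neighbour in D of a vertex v outside D lies in the tight set that blocks
   the addition of v, hence in Q. *)
have outer v : v \in A -> v \notin D -> forall u, u \in D -> edge v u -> u \in Q.
  move=> vA vD u uD vu.
  have : ~~ good (v |: D).
    by apply/negP=> /maxD; rewrite cardsU1 vD /= -ltnS add1n ltnn.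
  rewrite /good subUset sub1set vA DA (subset_trans SD (subsetUr _ _)) /=.
  case/forallPn=> P; rewrite negb_imply -ltnNge => /andP[PvD ltP].
  have PvD' : P :\ v \subset D by rewrite subDset.
  have bsub : boundary S D (P :\ v) \subset boundary S (v |: D) P.
    apply/subsetP=> w /boundaryP[/setD1P[_ wP] H].
    apply/boundaryP; split=> //; case: H => [|[x [xD]]]; first by left.
    rewrite !inE negb_and negbK => /orP[/eqP xv|xP] wx; first by rewrite xv (negbTE vD) in xD.
    by right; exists x; rewrite !inE xD orbT.
  have cb := leq_mul (leqnn c) (subset_leq_card bsub).
  have c1 := cardsD1 v P.
  have gP := gD _ PvD'.
  have vP : v \in P by case: (v \in P) c1 => //=; move: gP ltP cb; clear; lia.
  rewrite vP in c1.
  have eqb : boundary S D (P :\ v) = boundary S (v |: D) P.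
    by apply/eqP; rewrite eqEcard bsub -(leq_pmul2l c0) /=; move: c1 gP ltP; clear; lia.
  have tP : tight (P :\ v) by rewrite /tight PvD' /= eqb; move: c1 ltP; clear; lia.
  apply: (subsetP (subQ _ tP)); apply: contraT => uP.
  have : v \in boundary S D (P :\ v).
    rewrite eqb; apply/boundaryP; split=> //; right; exists u; split=> //.
      by rewrite !inE uD orbT.
    move: uP; rewrite !inE negb_and negbK => /orP[/eqP uv|//].
    by rewrite uv (negbTE vD) in uD.
  by move/(subsetP (boundary_sub _ _ _)); rewrite !inE eqxx.
have bR : boundary S A R \subset boundary S D Q.
  apply/subsetP=> v /boundaryP[vR H].
  have uDQ u : u \in A -> u \notin R -> (u \in D) /\ (u \notin Q).
    by move=> uA uR; have : u \in D :\: Q; [rewrite -AR inE uR | case/setDP].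
  case vD: (v \in D).
    have vQ : v \in Q by move: vR; rewrite !inE vD orbF.
    apply/boundaryP; split=> //; case: H => [|[u [uA uR vu]]]; first by left.
    by have [uD uQ] := uDQ u uA uR; right; exists u.
  have vA : v \in A by exact: (subsetP RA).
  case: H => [/(subsetP SD)|[u [uA uR vu]]]; first by rewrite vD.
  have [uD uQ] := uDQ u uA uR.
  by rewrite (outer v vA _ u uD vu) ?vD in uQ.
have := sat _ RA; rewrite AR cardsD (setIidPr QD).
move: tQ (leq_mul (leqnn c) (subset_leq_card bR)) (subset_leq_card QD); clear; lia.
Qed.

Definition separates U X Y :=
  X :|: Y = U /\ forall x y, x \in X :\: Y -> y \in Y :\: X -> ~~ edge x y.

Definition balanced_separations a :=
  forall V, exists X Y, [/\ separates V X Y, 3 * #|X :\: Y| <= 2 * #|V|,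
                            3 * #|Y :\: X| <= 2 * #|V| & #|X :&: Y| <= a].

Lemma separatesC U X Y : separates U X Y -> separates U Y X.
Proof. by case=> XY noedge; split=> [|x y xY yX]; rewrite 1?setUC // edge_sym noedge. Qed.

Lemma separates_edge U X Y x y : separates U X Y ->
  x \in X -> y \in U -> y \notin X -> edge x y -> x \in Y.
Proof.
move=> [XY noedge] xX yU yX xy; apply: contraT => xY.
suff : ~~ edge x y by rewrite xy.
apply: noedge; first by rewrite inE xY.
by move: yU; rewrite -XY !inE (negbTE yX).
Qed.

(** * The subgraph without a balanced separation *)

(** Here the part A of U is replaced with a subset A' that keeps the boundary S,
and X, Y are the sides of a separation of what remains. *)
Section ReplacedSide.

Variables (U A A' X Y : {set G}) (c : nat).
Let S := boundary set0 U A.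

Hypotheses (SA' : S \subset A') (A'A : A' \subset A).
Hypothesis sepXY : separates (A' :|: (U :\: A)) X Y.

Lemma boundary_join :
  boundary set0 U (X :|: A) \subset (S :&: Y) :|: (X :&: Y) :\: A.
Proof.
have [XY _] := sepXY.
apply/subsetP=> v /boundaryP[vXA [|[u [uU]]]]; first by rewrite inE.
rewrite inE negb_or => /andP[uX uA] vu.
have uH : u \in A' :|: (U :\: A) by rewrite !inE uA uU orbT.
apply/setUP; case vA: (v \in A); last first.
  have vX : v \in X by case/setUP: vXA; rewrite ?vA.
  right; apply/setDP; split; rewrite ?vA //.
  by apply/setIP; split=> //; exact: (separates_edge sepXY vX uH uX vu).
have vS : v \in S by apply/boundaryP; split=> //; right; exists u.
left; apply/setIP; split=> //.
case vX: (v \in X); first exact: (separates_edge sepXY vX uH uX vu).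
have : v \in X :|: Y by rewrite XY inE (subsetP SA').
by rewrite inE vX.
Qed.

(** The minimality of A bounds X outside A, where the boundary of X :|: A has lost
the vertices of S that lie only in X; the hypothesis on A' bounds X inside A,
where exactly these vertices come back as boundary. The terms in S cancel, and
only X :&: Y remains. *)
Lemma light_side :
  (forall P, P \subset A' -> #|P| <= c * #|boundary S A' P|) ->
  #|U :\: A| + c * #|S| <=
    #|U :\: (X :|: A)| + c * #|boundary set0 U (X :|: A)| ->
  #|X| <= c * #|X :&: Y|.
Proof.
move=> flow opt; have [XY _] := sepXY.
have XH v : v \in X -> v \in A' \/ (v \in U /\ v \notin A).
  move=> vX; have : v \in X :|: Y by rewrite inE vX.
  by rewrite XY !inE => /orP[->|/andP[-> ->]]; [left|right].
have XAA' : X :&: A = X :&: A'.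
  apply/setP=> v; rewrite !inE; case vX: (v \in X) => //=.
  have := subsetP A'A v; case: (XH v vX) => [-> ->//|[_ /negbTE vA]].
  by rewrite vA; case: (v \in A') => // ->.
have cU : #|U :\: A| = #|U :\: (X :|: A)| + #|X :\: A|.
  rewrite -(cardsID X (U :\: A)) addnC; congr (_ + _); apply: eq_card => v.
    by rewrite !inE negb_or andbA.
  rewrite !inE; case vX: (v \in X); rewrite ?andbF //= andbT.
  case vA: (v \in A) => //=; case: (XH v vX) => [|[]//].
  by move/(subsetP A'A); rewrite vA.
have inner : boundary S A' (X :&: A') \subset (S :\: Y) :|: (X :&: Y) :&: A.
  apply/subsetP=> v /boundaryP[/setIP[vX vA'] H].
  have vA := subsetP A'A _ vA'.
  apply/setUP; case vY: (v \in Y).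
    by right; apply/setIP; split=> //; apply/setIP.
  left; apply/setDP; rewrite vY; split=> //.
  case: H => [//|[u [uA']]].
  rewrite inE uA' andbT => uX vu.
  have uH : u \in A' :|: (U :\: A) by rewrite inE uA'.
  by have := separates_edge sepXY vX uH uX vu; rewrite vY.
have := flow _ (subsetIr X A').
have := leq_mul (leqnn c) (leq_trans (subset_leq_card inner) (leq_card_setU _ _)).
have := leq_mul (leqnn c) (leq_trans (subset_leq_card boundary_join) (leq_card_setU _ _)).
have := congr1 (muln c) (cardsID Y S); have := congr1 (muln c) (cardsID A (X :&: Y)).
have := cardsID A X; rewrite XAA' !mulnDr.
move: opt cU; clear; lia.
Qed.

End ReplacedSide.

(** Core of the argument. If no P with the stated properties exists, then every
P included in U has |W :&: P| <= |bd P| or |W :\: P| <= |bd P|; the sets of the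
first kind, called small below, play the role of the small sides of a tangle.
For an integer c, let A be a small set minimising |U :\: A| + c |bd A|, with
k = |bd A|. Trimming A to a set A' of exactly c k vertices gives a subgraph H
on A' and U :\: A with |U :\: A| + c k vertices. A side X of a separation of H
of order at most a has at most c a vertices as soon as X :|: A is small, by
[light_side], and one of X :|: A and Y :|: A is small because W is too large to
be covered otherwise. So H has no balanced separation of order at most a when
|H| > 3 a c; choosing c just below the first integer where the minimum above is
at most 3 a times this integer ensures it, and also forces k < 3 a. *)
Lemma exists_splitting_set a U W : 0 < a -> balanced_separations a ->
  W \subset U -> #|W| = 10 * a ->
  exists P, [/\ P \subset U, #|boundary set0 U P| < #|W :&: P|
                & #|boundary set0 U P| < #|W :\: P|].
Proof.
move=> a0 bal WU cW.
set bd := boundary set0 U.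
case: (boolP [exists P : {set G}, [&& P \subset U, #|bd P| < #|W :&: P|
                & #|bd P| < #|W :\: P|]]) => [/existsP[P /and3P[]]|linked].
  by exists P.
have {}linked P : P \subset U -> #|W :&: P| <= #|bd P| \/ #|W :\: P| <= #|bd P|.
  move=> PU; apply/orP; move/existsPn/(_ P): linked.
  by rewrite PU !ltnNge /= negb_and !negbK.
pose small P := (P \subset U) && (#|W :&: P| <= #|bd P|).
have small_card P : small P -> 10 * a <= #|U :\: P| + #|bd P|.
  case/andP=> PU sP; rewrite -cW -(cardsID P W).
  have := subset_leq_card (setSD P WU); move: sP; clear; lia.
have small0 : small set0 by rewrite /small sub0set setI0 cards0.
have bd0 : #|bd set0| = 0.
  by apply/eqP; rewrite cards_eq0 -subset0 boundary_sub.
(* The least d with [light d] is positive, and c is its predecessor. *)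
pose light d := [exists P : {set G}, small P && (#|U :\: P| + d * #|bd P| <= 3 * a * d)].
have exd : exists d, light d.
  exists #|U|; apply/existsP; exists set0; rewrite small0 bd0 setD0 /=.
  by move: a0; clear; nia.
case: (ex_minnP exd) => -[|c] /existsP[P1 /andP[sP1 lP1]] mind.
  have /cards0_eq/eqP : #|U :\: P1| = 0 by move: lP1; clear; lia.
  rewrite setD_eq0 => UP1.
  have bdP1 : bd P1 = set0.
    apply/eqP; rewrite -subset0; apply/subsetP=> v /boundaryP[_ [|[u [uU]]]].
      by rewrite inE.
    by rewrite (subsetP UP1).
  have := small_card _ sP1; rewrite bdP1 cards0.
  by move: lP1 a0; clear; lia.
have {mind} heavy P : small P -> 3 * a * c < #|U :\: P| + c * #|bd P|.
  move=> sP; rewrite ltnNge; apply/negP=> lP.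
  suff /mind : light c by rewrite ltnn.
  by apply/existsP; exists P; rewrite sP.
case: (arg_minnP (fun P : {set G} => #|U :\: P| + c * #|bd P|) small0) => A sA minA.
have [AU WA] := andP sA.
have c0 : 0 < c.
  rewrite lt0n; apply/eqP=> c0; move: (small_card _ sP1) lP1 a0.
  by rewrite c0; clear; lia.
set S := bd A.
(* Comparing with P1 gives |U :\: A| + c |S| <= 3 a (c + 1), while the left side
   is at least 10 a + (c - 1) |S|. *)
have kS : #|S| < 3 * a.
  move: (minA _ sP1) lP1 (small_card _ sA) c0 a0; rewrite /= -/S; clear.
  by nia.
have SA : S \subset A := boundary_sub _ _ _.
(* The cut condition for A is the minimality of A among small sets; subsets of A
   that are not small have a boundary at least as large as S. *)
have sat P : P \subset A -> c * #|S| <= #|A :\: P| + c * #|boundary S A P|.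
  move=> PA.
  have bdP : #|bd P| <= #|boundary S A P|.
    apply/subset_leq_card/subsetP=> v /boundaryP[vP [|[u [uU uP vu]]]].
      by rewrite inE.
    apply/boundaryP; split=> //; case uA: (u \in A); first by right; exists u.
    left; apply/boundaryP; split; first exact: (subsetP PA).
    by right; exists u; rewrite uA.
  case: (leqP #|S| #|bd P|) => [le|lt].
    move: (leq_mul (leqnn c) (leq_trans le bdP)); clear; lia.
  have PU := subset_trans PA AU.
  case: (linked P PU) => [sP|bigP].
    have /minA /= : small P by rewrite /small PU.
    have -> : #|U :\: P| = #|U :\: A| + #|A :\: P|.
      rewrite -(cardsID A (U :\: P)) addnC; congr (_ + _); apply: eq_card => v.
        rewrite !inE; case vA: (v \in A) => //=.
        by rewrite (contraFN (subsetP PA v) vA).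
      rewrite !inE; case vA: (v \in A); rewrite ?andbF // andbT.
      by rewrite (subsetP AU) ?andbT.
    by move: (leq_mul (leqnn c) bdP); rewrite -/S; clear; lia.
  have := subset_leq_card (setIS W PA); have := cardsID P W.
  by move: WA bigP lt kS cW; rewrite -/S; clear; lia.
have [A' [SA' A'A cA' flow]] := saturated_subset SA c0 sat.
set H := A' :|: (U :\: A).
have cH : #|H| = c * #|S| + #|U :\: A|.
  rewrite cardsU cA'; have -> : A' :&: (U :\: A) = set0; last by rewrite cards0 subn0.
  apply/setP=> v; rewrite !inE; case vA': (v \in A') => //=.
  by rewrite (subsetP A'A).
have cH3 : 3 * a * c < #|H| by rewrite cH addnC; exact: heavy.
have unbalanced X Y : separates H X Y -> 3 * #|Y :\: X| <= 2 * #|H| ->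
    #|X :&: Y| <= a ->
    #|W :\: (X :|: A)| <= #|S :&: Y| + #|(X :&: Y) :\: A|.
  move=> sepXY balY cXY.
  have XAU : X :|: A \subset U.
    rewrite subUset AU andbT; apply: subset_trans (subsetUl X Y) _.
    by case: sepXY => -> _; rewrite subUset subsetDl (subset_trans A'A).
  apply: leq_trans _ (leq_trans (subset_leq_card (boundary_join SA' sepXY))
                     (leq_card_setU _ _)).
  case: (linked _ XAU) => // sXA.
  have /minA opt : small (X :|: A) by rewrite /small XAU.
  have := leq_trans (light_side SA' A'A sepXY flow opt) (leq_mul (leqnn c) cXY).
  have : #|H| = #|X| + #|Y :\: X|.
    by case: sepXY => <- _; rewrite cardsU cardsD setIC; have := subset_leq_card (subsetIl Y X); clear; lia.
  by move: cH3 balY; clear; nia.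
have [X [Y [sepXY balX balY cXY]]] := bal H.
have hX := unbalanced X Y sepXY balY cXY.
have hY : #|W :\: (Y :|: A)| <= #|S :&: X| + #|(X :&: Y) :\: A|.
  by rewrite (setIC X); apply: unbalanced => //; [exact: separatesC | rewrite setIC].
(* The terms below add up to at most 2 |S| + 3 a < 9 a, whereas |W| = 10 a. *)
have cover : W \subset (W :&: A) :|: (W :\: (X :|: A)) :|: (W :\: (Y :|: A))
                       :|: ((X :&: Y) :\: A).
  apply/subsetP=> v vW; rewrite !inE vW.
  by case: (v \in A); case: (v \in X); case: (v \in Y).
have := subset_leq_card cover.
have cU4 (B1 B2 B3 B4 : {set G}) : #|B1 :|: B2 :|: B3 :|: B4| <= #|B1| + #|B2| + #|B3| + #|B4|.
  rewrite !cardsU; clear; lia.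
move/leq_trans/(_ (cU4 _ _ _ _)); rewrite cW.
have := subset_leq_card (subsetDl (X :&: Y) A).
have : #|S :&: X| + #|S :&: Y| <= #|S| + #|X :&: Y|.
  rewrite -cardsUI; apply: leq_add; apply: subset_leq_card.
    by rewrite subUset !subsetIl.
  by apply/subsetP=> v /setIP[/setIP[_ vX] /setIP[_ vY]]; apply/setIP.
move: hX hY cXY kS WA a0; rewrite -/S; clear; lia.
Qed.


(** * Decompositions as lists of bags *)

(** Tree-decompositions are built as lists of bags, in which each bag shares with
the earlier ones only vertices of a single earlier bag, its parent in the tree.
In this form, gluing two decompositions is concatenation. *)
Definition running_intersection (s : seq {set G}) :=
  forall i, 0 < i < size s -> exists2 p, p < i &
    forall x j, j < i -> x \in nth set0 s i -> x \in nth set0 s j ->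
      x \in nth set0 s p.

Lemma running_intersection_cat s1 s2 k :
  running_intersection s1 -> running_intersection s2 -> k < size s1 ->
  (forall x (B1 B2 : {set G}), B1 \in s1 -> B2 \in s2 -> x \in B1 -> x \in B2 ->
     x \in nth set0 s1 k /\ x \in nth set0 s2 0) ->
  running_intersection (s1 ++ s2).
Proof.
move=> ri1 ri2 ks1 common i; rewrite size_cat => /andP[i0 i12].
case: (ltnP i (size s1)) => [i1|i2].
  have [|p pi H] := ri1 i; first by rewrite i0.
  exists p => // x j ji; rewrite !nth_cat i1 (ltn_trans pi i1) (ltn_trans ji i1).
  exact: H.
have i2' : i - size s1 < size s2 by rewrite ltn_subLR.
case: (posnP (i - size s1)) => [i2z|i2p].
  exists k; first exact: leq_trans i2.
  move=> x j ji; rewrite !nth_cat ltnNge i2 /= i2z ks1.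
  case: ltnP => [j1 x2 x1|j2]; last by move: ji j2 i2z; clear; lia.
  by case: (common x _ _ (mem_nth set0 j1) (mem_nth set0 i2') x1) => //; rewrite i2z.
have [|p pi H] := ri2 (i - size s1); first by rewrite i2p.
exists (size s1 + p); first by move: pi; clear; lia.
move=> x j ji; rewrite !nth_cat ltnNge i2 [_ + p < _]ltnNge leq_addr addKn /=.
case: ltnP => [j1 x2 x1|j2 x2]; last by apply: H => //; move: ji j2; clear; lia.
apply: (H x 0) => //.
by case: (common x _ _ (mem_nth set0 j1) (mem_nth set0 i2') x1 x2).
Qed.

Definition decomposes U (s : seq {set G}) :=
  [/\ running_intersection s, forall x, (x \in U) = has (fun B : {set G} => x \in B) s &
      forall x y, x \in U -> y \in U -> edge x y ->
        has (fun B : {set G} => (x \in B) && (y \in B)) s].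

Lemma decomposes1 U : decomposes U [:: U].
Proof.
split=> [[|i]|x|x y xU yU _] //=; last by rewrite xU yU.
by rewrite orbF.
Qed.

Lemma decomposes_glue U X Y (C CX CY : {set G}) sX sY : separates U X Y -> C \subset U ->
  X :&: Y \subset C -> C :&: X \subset CX -> C :&: Y \subset CY ->
  decomposes X (CX :: sX) -> decomposes Y (CY :: sY) ->
  decomposes U (C :: (CX :: sX) ++ CY :: sY).
Proof.
move=> sepXY CU XYC CXX CYY [riX memX edX] [riY memY edY].
have [XY _] := sepXY.
have inX x (B : {set G}) : B \in CX :: sX -> x \in B -> x \in X.
  by move=> Bs xB; rewrite memX; apply/hasP; exists B.
have inY x (B : {set G}) : B \in CY :: sY -> x \in B -> x \in Y.
  by move=> Bs xB; rewrite memY; apply/hasP; exists B.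
split.
- rewrite -cat1s catA.
  apply: (@running_intersection_cat _ _ 0) => //.
    apply: (@running_intersection_cat _ _ 0) => //; first by case.
    move=> x B1 B2; rewrite inE => /eqP-> sB2 xC xB2; split=> //=.
    by apply: (subsetP CXX); rewrite inE xC (inX x B2).
  move=> x B1 B2; rewrite cat1s inE => sB1 sB2 xB1 xB2.
  have xY := inY x B2 sB2 xB2.
  have xC : x \in C.
    case/orP: sB1 xB1 => [/eqP->//|sB1 xB1].
    by apply: (subsetP XYC); rewrite inE xY (inX x B1).
  by split=> //=; apply: (subsetP CYY); rewrite inE xC.
- move=> x; rewrite -cat1s !has_cat -memX -memY has_seq1 -XY inE /=.
  case xC: (x \in C) => //=; have := subsetP CU x xC.
  by rewrite -XY inE.
- move=> x y xU yU xy; rewrite -cat1s !has_cat.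
  have in_side : (x \in X) && (y \in X) || (x \in Y) && (y \in Y).
    have xXY : (x \in X) || (x \in Y) by rewrite -in_setU XY.
    have yXY : (y \in X) || (y \in Y) by rewrite -in_setU XY.
    case xX: (x \in X) xXY; case yX: (y \in X) yXY => //= yY xY.
    - by rewrite yY (separates_edge sepXY xX yU (negbT yX) xy).
    - by rewrite xY (separates_edge sepXY yX xU (negbT xX)) // edge_sym.
    - by rewrite xY.
  case/orP: in_side => /andP[x1 y1].
    by rewrite (edX _ _ x1 y1 xy) !orbT.
  by rewrite (edY _ _ x1 y1 xy) !orbT.
Qed.

Lemma extend_set (R U : {set G}) m : R \subset U -> #|R| <= m <= #|U| ->
  exists W : {set G}, [/\ R \subset W, W \subset U & #|W| = m].
Proof.
move=> RU /andP[Rm mU].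
pose ok (W : {set G}) := [&& R \subset W, W \subset U & #|W| <= m].
have okR : ok R by rewrite /ok subxx RU.
case: (arg_maxnP (fun W : {set G} => #|W|) okR) => W /and3P[RW WU Wm] maxW.
exists W; split=> //; apply/eqP; rewrite eqn_leq Wm leqNgt; apply/negP=> ltW.
have /properP[_ [x xU xW]] : W \proper U by rewrite properEcard WU (leq_trans ltW).
have /maxW /= : ok (x |: W).
  rewrite /ok subUset sub1set xU WU (subset_trans RW (subsetUr _ _)) /=.
  by rewrite cardsU1 xW.
by rewrite cardsU1 xW add1n ltnn.
Qed.

(** Recursion on U, with R required to lie in the first bag. Enlarge R to a set W
of size 10 a; the separation of [exists_splitting_set] has order less than |W :&: P| and
|W :\: P|, hence less than 5 a. The first bound makes the root sets of both
sides have size at most 10 a, the second bounds the new bag by 15 a. *)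
Lemma small_bags a (U R : {set G}) : 0 < a -> balanced_separations a ->
  R \subset U -> #|R| <= 10 * a ->
  exists (C : {set G}) s, [/\ R \subset C, decomposes U (C :: s)
                & forall B : {set G}, B \in C :: s -> #|B| <= 15 * a].
Proof.
move=> a0 bal; have [n leUn] := ubnP #|U|; elim: n => // n IH in U R leUn *.
move=> RU cR; case: (leqP #|U| (10 * a)) => [cU|ltU].
  exists U, [::]; split=> // [|B]; first exact: decomposes1.
  by rewrite inE => /eqP->; move: cU; clear; lia.
have [|W [RW WU cW]] := @extend_set R U (10 * a) RU; first by rewrite cR ltnW.
have [P [PU ltP ltU']] := exists_splitting_set a0 bal WU cW.
set Z := boundary set0 U P in ltP ltU'.
have ZP : Z \subset P := boundary_sub _ _ _.
pose Y := (U :\: P) :|: Z.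
have YU : Y \subset U by rewrite subUset subsetDl (subset_trans ZP).
have PYZ : P :&: Y = Z.
  apply/setP=> x; rewrite in_setI in_setU in_setD.
  case xP: (x \in P) => //=; last by rewrite (contraFF (subsetP ZP x) xP).
have sepPY : separates U P Y.
  split=> [|x y /setDP[xP xY] /setDP[/setUP[/setDP[yU yP] _|/(subsetP ZP)->//]]].
    apply/setP=> x; rewrite in_setU in_setU in_setD.
    have := subsetP PU x; have := subsetP ZP x.
    by case: (x \in P); case: (x \in U); case: (x \in Z) => //= H1 H2;
       rewrite ?H1 ?H2.
  apply/negP=> xy; case/negP: xY; apply/setUP; right.
  by apply/boundaryP; split=> //; right; exists y.
have cWP := cardsID P W.
have cY : #|Y| < #|U|.
  apply: proper_card; rewrite properEneq YU andbT; apply/eqP=> YeqU.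
  have := subset_leq_card (subsetIr W P); move: ltP; rewrite -PYZ YeqU (setIidPl PU).
  by clear; lia.
have cP : #|P| < #|U|.
  have := cardsID P U; rewrite (setIidPr PU).
  have := subset_leq_card (setSD P WU); move: ltU'; clear; lia.
have rootP : #|(W :|: Z) :&: P| <= 10 * a.
  rewrite setIUl (setIidPl ZP); apply: leq_trans (leq_card_setU _ _) _.
  by move: cWP ltU' cW; clear; lia.
have rootY : #|(W :|: Z) :&: Y| <= 10 * a.
  have sub : (W :|: Z) :&: Y \subset (W :\: P) :|: Z.
    apply/subsetP=> x /setIP[/setUP[xW|xZ] /setUP[/setDP[_ xP]|xZ']]; apply/setUP;
      by [right | left; apply/setDP].
  apply: leq_trans (leq_trans (subset_leq_card sub) (leq_card_setU _ _)) _.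
  by move: cWP ltP cW; clear; lia.
have [|CX [sX [CXr dX bX]]] := IH P ((W :|: Z) :&: P) _ (subsetIr _ _) rootP.
  by move: cP leUn; clear; lia.
have [|CY [sY [CYr dY bY]]] := IH Y ((W :|: Z) :&: Y) _ (subsetIr _ _) rootY.
  by move: cY leUn; clear; lia.
exists (W :|: Z), ((CX :: sX) ++ CY :: sY); split.
- exact: subset_trans RW (subsetUl _ _).
- apply: decomposes_glue dX dY => //; last by rewrite PYZ subsetUr.
  by rewrite subUset WU (subset_trans ZP).
- move=> B; rewrite in_cons mem_cat => /orP[/eqP->|/orP[/bX|/bY]//].
  apply: leq_trans (leq_card_setU _ _) _.
  by move: cWP ltP ltU' cW; clear; lia.
Qed.

End Separations.

(** * From lists of bags to trees *)

Section ParentTree.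

Variables (n : nat) (parent : nat -> nat).
Hypothesis parent_lt : forall i, 0 < i < n -> parent i < i.

Definition parent_edge (i j : 'I_n) :=
  (i < j) && (parent j == i) || (j < i) && (parent i == j).

Lemma parent_edge_sym : symmetric parent_edge.
Proof. by move=> i j; rewrite /parent_edge orbC. Qed.

Definition parent_tree : graph := Graph parent_edge_sym.

(** Of two distinct vertices of S, the larger can be moved to its parent inside S,
and this terminates because parents are smaller. *)
Lemma parent_connected (S : {set parent_tree}) :
  (forall t u v : parent_tree, t \in S -> u \in S -> (u < t)%N ->
     nat_of_ord v = parent t -> v \in S) ->
  connected_in S.
Proof.
move=> closedS x y xS yS.
set r := (X in connect X).
have r_sym : connect_sym r.
  by apply: sym_connect_sym => i j; rewrite /r /= parent_edge_sym andbCA.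
have [m] := ubnP (nat_of_ord x + nat_of_ord y); elim: m => // m IH in x y xS yS *.
have step (t u : parent_tree) : t \in S -> u \in S -> (u < t)%N ->
    exists v : parent_tree, [/\ (v < t)%N, v \in S & r t v].
  move=> tS uS ut.
  have pt : parent t < t by apply: parent_lt; rewrite ltn_ord (leq_ltn_trans _ ut).
  pose v : parent_tree := Ordinal (ltn_trans pt (ltn_ord t)).
  have vS : v \in S by apply: (closedS t u).
  by exists v; split=> //; rewrite /r /= tS vS /edge /= /parent_edge /= pt eqxx orbT.
move=> le; case: (ltngtP (nat_of_ord x) (nat_of_ord y)) => [xy|yx|/val_inj->//].
- have [v [vy vS yv]] := step y x yS xS xy.
  rewrite r_sym; apply: connect_trans (connect1 yv) _; rewrite r_sym.
  by apply: IH => //; move: vy le; clear; lia.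
- have [v [vx vS xv]] := step x y xS yS yx.
  apply: connect_trans (connect1 xv) _.
  by apply: IH => //; move: vx le; clear; lia.
Qed.

Lemma parent_treeP : 0 < n -> tree parent_tree.
Proof.
move=> n0; split.
- by rewrite card_ord.
- by move=> i; rewrite /edge /= /parent_edge ltnn.
- by apply: parent_connected => *; rewrite inE.
- move=> c /andP[cyc unc]; rewrite leqNgt; apply/negP=> size_c.
  have [i0 i0c] : exists i0, i0 \in c by case: c size_c {cyc unc} => // i0 c; exists i0; rewrite mem_head.
  (* Both neighbours of the largest vertex of the cycle equal its parent. *)
  case: (arg_maxnP (fun i : parent_tree => nat_of_ord i) i0c) => i ic maxi.
  have [k c' Ec] := rot_to ic.
  have [cyc' unc' sz'] : [/\ cycle edge (i :: c'), uniq (i :: c') & 2 < size (i :: c')].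
    by rewrite -Ec rot_cycle rot_uniq size_rot.
  have maxi' j : j \in c' -> (j <= i)%N.
    move=> jc; have : j \in rot k c by rewrite Ec inE jc orbT.
    by rewrite mem_rot => /maxi.
  have up (j : parent_tree) : j \in c' -> edge i j -> nat_of_ord j = parent i.
    move=> /maxi' ji; rewrite /edge /= /parent_edge ltnNge ji /=.
    by case/andP=> _ /eqP.
  case/lastP: c' => [|c' z] // in Ec cyc' unc' sz' maxi' up *.
  case: c' => [|y c'] // in Ec cyc' unc' sz' maxi' up *.
  move: cyc'; rewrite /= rcons_path last_rcons => /andP[iy /andP[_ zi]].
  have Ey := up y (mem_head _ _) iy.
  have Ez : nat_of_ord z = parent i.
    by apply: up; [rewrite mem_rcons mem_head | rewrite edge_sym].
  have yz : y = z by apply: val_inj; rewrite /= Ey Ez.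
  by move: unc'; rewrite /= yz mem_rcons mem_head andbF.
Qed.

End ParentTree.

Lemma decomposes_tw (G : graph) (s : seq {set G}) w :
  0 < size s -> decomposes [set: G] s -> (forall B : {set G}, B \in s -> #|B| <= w.+1) ->
  tw G <= w.
Proof.
move=> s0 [ri cov edges] small.
have /choice[p pP] : forall i, exists q, 0 < i < size s -> q < i /\
    forall x j, j < i -> x \in nth set0 s i -> x \in nth set0 s j ->
      x \in nth set0 s q.
  move=> i; case: (boolP (0 < i < size s)) => [/ri[q qi Hq]|]; last by exists 0.
  by exists q.
have p_lt i : 0 < i < size s -> p i < i by case/pP.
pose T := @parent_tree (size s) p.
pose bag (t : T) := nth set0 s (nat_of_ord t).
have width_bag : width bag <= w.
  rewrite /width -subn1 leq_subLR add1n; apply/bigmax_leqP=> t _.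
  by apply: small; exact: mem_nth.
apply: leq_trans width_bag.
rewrite /tw; case: ex_minnP => k _; apply; apply/asboolP; exists T, bag; split=> //.
split.
- exact: parent_treeP.
- move=> x; have := cov x; rewrite inE => /esym/hasP[B sB xB].
  have iB : index B s < size s by rewrite index_mem.
  by exists (Ordinal iB); rewrite /bag /= nth_index.
- move=> x y xy; have /hasP[B sB /andP[xB yB]] := edges x y (in_setT _) (in_setT _) xy.
  have iB : index B s < size s by rewrite index_mem.
  by exists (Ordinal iB); rewrite /bag /= nth_index.
- move=> x; apply: parent_connected => // t u v; rewrite !inE => xt xu ut vt.
  have t0 : 0 < t < size s by rewrite ltn_ord (leq_ltn_trans _ ut).
  by rewrite /bag vt; apply: (proj2 (pP _ t0)) ut xt xu.
Qed.

(** * Treewidth and separation number *)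

Lemma sn_at_most_sets (G : graph) a :
  sn_at_most G a -> balanced_separations G a.
Proof.
move=> sna V.
pose ed (x y : G) := [&& x \in V, y \in V & edge x y].
have ed_sym : symmetric ed by move=> x y; rewrite /ed edge_sym andbCA.
have edP x y : ed x y -> [/\ x \in V, y \in V & edge x y] by case/and3P.
pose H := Subgraph ed_sym edP.
have [A [B [[AB noedge] [balA balB] cAB]]] := sna H.
have cH : #|H| = #|V| by rewrite /= card_sig; apply: eq_card => x; rewrite inE.
pose im (C : {set H}) : {set G} := [set val x | x in C].
have imI C D : im (C :&: D) = im C :&: im D by apply: imsetI => ? ? _ _; exact: val_inj.
have imD C D : im (C :\: D) = im C :\: im D.
  apply/setP=> x; apply/imsetP/setDP => [[y /setDP[yC yD] ->]|[/imsetP[y yC ->] yD]].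
    by split; rewrite mem_imset //; exact: val_inj.
  by exists y => //; rewrite inE yC andbT; apply: contra yD => yD; exact: imset_f.
have cim C : #|im C| = #|C| by apply: card_imset; exact: val_inj.
exists (im A), (im B); rewrite -imI -!imD !cim -cH; split=> //; split.
  rewrite -imsetU AB; apply/setP=> x; apply/imsetP/idP => [[y _ ->]|xV].
    exact: (valP y).
  by exists (exist _ x xV).
move=> u v; rewrite -!imD => /imsetP[x xAB ->] /imsetP[y yBA ->].
have := noedge x y xAB yBA; apply: contra => xy.
rewrite /edge /= /ed xy andbT; apply/andP; split; exact: valP.
Qed.

Theorem theorem1 (G : graph) : tw G <= 15 * sn G.
Proof.
rewrite /sn; case: ex_minnP => a /asboolP/sn_at_most_sets bal _.
(* Separations of order 0 are not balanced on a single vertex. *)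
case: (posnP a) => [a0|a0].
  have noV (x : G) : False.
    have [X [Y [[XY _]]]] := bal [set x]; rewrite cards1 a0 leqn0 cards_eq0.
    move=> cX cY /eqP XY0; have := congr1 (fun Z : {set G} => #|Z|) XY.
    rewrite cards1 cardsU XY0 cards0; have := cardsID Y X; have := cardsID X Y.
    by rewrite (setIC Y) XY0 cards0; move: cX cY; clear; lia.
  apply: (@decomposes_tw _ [:: setT]) => // [|B]; first exact: decomposes1.
  rewrite inE => /eqP->; apply: (@leq_trans 0) => //; rewrite leqn0 cards_eq0.
  by apply/eqP/setP=> x; case: (noV x).
have [|C [s [_ dec small]]] := small_bags a0 bal (sub0set [set: G]).
  by rewrite cards0.
by apply: decomposes_tw dec _ => // B /small/leqW.
Qed.
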